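(* Let $k\geq 2$ and let $T$ be a knockout tournament whose players are the elements of $GF(2^k)$ such that $v_T(x,y)=1+d(x-y)$ for all distinct $x,y\in GF(2^k)$. For each nonzero $z\in GF(2^k)$, let $T(z)$ be the knockout tournament obtained from $T$ by replacing each player $x$ with $zx$. Then $$\mathcal{T}:=\{T(z): z\text{ a nonzero element of } GF(2^k)\}$$ is a stable Serial Knockout Competition.
   Context: Knockout tournaments. A (balanced) knockout tournament $T$ on $n=2^k$ players is given by a seeding, i.e. an ordering $s=s_0s_1\cdots s_{n-1}$ of the players assigned from left to right to the leaves of a complete binary tree of depth $k$. In round $1$ the players in positions $2j$ and $2j+1$ meet; in each later round, the winners of the two subtrees below a node meet. For distinct players $x,x'$ we write $v_T(x,x')=i$ if $x,x'$ can meet in round $i$ of $T$ (assuming both win all earlier matches); equivalently, if $x,x'$ are in positions $p,p'$, then $i\in\{1,\ldots,k\}$ is the smallest integer with $\lfloor p/2^i\rfloor=\lfloor p'/2^i\rfloor$. Stability. A set $\mathcal{T}$ of knockout tournaments on the same $n=2^k$ players is stable in round $i$ if there is a number $c_i$ such that $\#\{T\in\mathcal{T}: v_T(x,x')=i\}=c_i$ for all pairs of distinct players $x,x'$. The set $\mathcal{T}$ is stable if it is stable in all rounds $i=1,\ldots,k$. A Serial Knockout Competition (SKC) for $n=2^k$ players is a competition consisting of $n-1$ knockout tournaments on these players. Galois field and degree. Fix an irreducible polynomial $q\in\mathbb{Z}_2[X]$ of degree $k$ and let $GF(2^k)=\mathbb{Z}_2[X]/(q)$, with $\alpha$ the class of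 $X$. Each element $x\in GF(2^k)$ is uniquely written as $x=\sum_{i=0}^{k-1}x_i\alpha^i$ with $x_i\in\{0,1\}$; for $x\neq 0$ its degree is $d(x)=\max\{i: x_i\neq 0\}$. A tournament $T$ with $v_T(x,y)=1+d(x-y)$ for all distinct $x,y$ exists; replacing each player $x$ by $zx$ means that the leaf occupied by $x$ in $T$ is occupied by $zx$ in $T(z)$. *)

(* Defs.v *)
From HB Require Import structures.
From mathcomp Require Import all_boot all_order all_algebra all_fingroup all_field.

Set Implicit Arguments.
Unset Strict Implicit.
Unset Printing Implicit Defensive.

Import GRing.Theory.
Local Open Scope ring_scope.

(* The seeding lists every player exactly once, from the leftmost leaf to the
   rightmost one; in particular #|P| = 2 ^ k. *)
Record knockout (k : nat) (P : finType) := Knockout {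
  seeding : (2 ^ k).-tuple P;
  seedingP : perm_eq seeding (enum P)
}.

HB.instance Definition _ k P := [isSub for @seeding k P].
HB.instance Definition _ k P := [Finite of knockout k P by <:].

Section Tournaments.
Variables (k : nat) (P : finType).
Implicit Types (T : knockout k P) (Ts : {set knockout k P}) (x y : P).

Definition position T x : nat := index x (seeding T).

Lemma position_lt T x : (position T x < 2 ^ k)%N.
Proof.
by rewrite -[X in (_ < X)%N](size_tuple (seeding T)) index_mem (perm_mem (seedingP T)) mem_enum.
Qed.

Definition same_subtree T x y (i : nat) : bool :=
  (position T x %/ 2 ^ i == position T y %/ 2 ^ i)%N.

Lemma same_subtree_top T x y : same_subtree T x y k.
Proof. by rewrite /same_subtree !divn_small ?position_lt. Qed.

Lemma meeting_exists T x y : exists i, (0 < i)%N && same_subtree T x y i.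
Proof.
exists k.+1; rewrite /same_subtree !divn_small //;
  by rewrite (leq_trans (position_lt T _)) // leq_pexp2l.
Qed.

(* Only meaningful for distinct x and y. *)
Definition meeting_round T x y : nat := ex_minn (meeting_exists T x y).

Lemma meeting_round_bounds T x y :
  x != y -> (0 < meeting_round T x y <= k)%N.
Proof.
move=> xy; rewrite /meeting_round; case: ex_minnP => i /andP[-> _] /= min_i.
apply: min_i; rewrite same_subtree_top andbT lt0n.
apply: contra_neq xy => k0.
have sz z : position T z = 0%N.
  by have := position_lt T z; rewrite k0; case: position.
have mem z : z \in seeding T by rewrite (perm_mem (seedingP T)) mem_enum.
by rewrite -(nth_index x (mem x)) -(nth_index x (mem y)) -!/(position _ _) !sz.
Qed.

Definition stable_in_round Ts (i : nat) : Prop :=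
  exists c : nat, forall x y, x != y ->
    #|[set T in Ts | meeting_round T x y == i]| = c.

Definition stable Ts : Prop :=
  forall i : nat, (1 <= i <= k)%N -> stable_in_round Ts i.

Definition serial_knockout_competition Ts : Prop := #|Ts| = (2 ^ k - 1)%N.

Fact replace_subproof T (f : P -> P) (f_inj : injective f) :
  perm_eq (map_tuple f (seeding T)) (enum P).
Proof.
apply: uniq_perm; rewrite ?enum_uniq //=.
  by rewrite map_inj_uniq // (perm_uniq (seedingP T)) enum_uniq.
move=> y; rewrite mem_enum [RHS]inE; have [g _ gK] := injF_bij f_inj.
by rewrite -(gK y) map_f // (perm_mem (seedingP T)) mem_enum.
Qed.

(* The leaf occupied by x in T is occupied by f x in replace_players T f_inj. *)
Definition replace_players T (f : P -> P) (f_inj : injective f) : knockout k P :=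
  Knockout (replace_subproof T f_inj).

End Tournaments.

Lemma F2_irreducible_monic (q : {poly 'F_2}) :
  irreducible_poly q -> monic_irreducible_poly q.
Proof.
move=> qI; split=> //; apply/monicP.
have : lead_coef q != 0.
  by rewrite lead_coef_eq0 -size_poly_gt0; case: qI => /ltnW.
by move: (lead_coef q) => c; case: c => [[|[|]] //= i] _; apply/val_inj.
Qed.

Notation GF qI := {poly %/ _ with F2_irreducible_monic qI}.

Section Galois.
Variables (q : {poly 'F_2}) (qI : irreducible_poly q).

(* {poly %/ q} consists of the remainders modulo q, so that the coordinates of
   x in the basis (alpha ^ i)_(i < deg q), for alpha the class 'qX of 'X, are
   the coefficients of x seen as a polynomial; see coordinatesE and
   coordinates_uniq below. *)
Definition coordinate (x : GF qI) (i : nat) : 'F_2 := (x : {poly 'F_2})`_i.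

Lemma size_GF (x : GF qI) : (size (x : {poly 'F_2}) <= (size q).-1)%N.
Proof. by case: x => p /=; rewrite unfold_in /= mk_monicE //; exact: F2_irreducible_monic. Qed.

Lemma sum_in_qpoly (c : nat -> 'F_2) :
  \sum_(i < (size q).-1) c i *: ('qX : {poly %/ q}) ^+ i
    = in_qpoly q (\poly_(i < (size q).-1) c i).
Proof.
rewrite poly_def linear_sum /=; apply: eq_bigr => i _.
by rewrite linearZ /= rmorphXn.
Qed.

Lemma coordinatesE (x : GF qI) :
  x = \sum_(i < (size q).-1) coordinate x i *: ('qX : GF qI) ^+ i.
Proof.
rewrite (sum_in_qpoly (coordinate x)).
have -> : \poly_(i < (size q).-1) coordinate x i = x :> {poly 'F_2}.
  apply/polyP => i; rewrite coef_poly; case: ltnP => // le_i.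
  by rewrite nth_default // (leq_trans (size_GF x)).
by apply: val_inj; rewrite [RHS]in_qpoly_small ?size_mk_monic.
Qed.

Lemma coordinates_uniq (x : GF qI) (c : nat -> 'F_2) :
  x = \sum_(i < (size q).-1) c i *: ('qX : GF qI) ^+ i ->
  forall i, (i < (size q).-1)%N -> coordinate x i = c i.
Proof.
move=> -> i lt_i; rewrite /coordinate (sum_in_qpoly c) in_qpoly_small.
  by rewrite coef_poly lt_i.
rewrite mk_monicE ?(leq_ltn_trans (size_poly _ _)) //; last first.
  exact: F2_irreducible_monic.
by case: qI => /ltnW; case: size.
Qed.

(* Only meaningful for x != 0. *)
Definition degree (x : GF qI) : nat :=
  (\max_(i < (size q).-1 | (coordinate x i != 0)%R) i)%N.

Definition tournament_mul (k : nat) (T : knockout k (GF qI))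
    (z : {z : GF qI | z != 0}) : knockout k (GF qI) :=
  replace_players T (mulfI (valP z)).

Definition tournament_family (k : nat) (T : knockout k (GF qI)) :
    {set knockout k (GF qI)} :=
  [set tournament_mul T z | z : {z : GF qI | z != 0}].

End Galois.

(* Main.v *)
(** The pair x, y meets in T(z) when x/z, y/z meet in T, that is in round
    1 + d((x - y)/z).  For fixed x != y the map z |-> (x - y)/z permutes the
    nonzero elements of the field, so the number of z for which this round is i
    equals the number of nonzero w of degree i - 1, whatever x and y are.
    The tournaments T(z) are distinct, since the leaf occupied by 1 in T is
    occupied by z in T(z). *)
Require Import Defs.
From mathcomp Require Import all_boot all_order all_algebra all_fingroup all_field.

Set Implicit Arguments.
Unset Strict Implicit.
Unset Printing Implicit Defensive.

Import GRing.Theory.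
Local Open Scope ring_scope.

Lemma mem_seeding (k : nat) (P : finType) (T : knockout k P) (x : P) :
  x \in seeding T.
Proof. by rewrite (perm_mem (seedingP T)) mem_enum. Qed.

Lemma card_players (k : nat) (P : finType) (T : knockout k P) :
  #|P| = (2 ^ k)%N.
Proof. by rewrite cardE -(perm_size (seedingP T)) size_tuple. Qed.

Lemma position_replace_players (k : nat) (P : finType) (T : knockout k P)
    (f : P -> P) (f_inj : injective f) (x : P) :
  position (replace_players T f_inj) (f x) = position T x.
Proof. exact: index_map. Qed.

(** The round depends only on the two leaves, and [f x] sits on the leaf that [x] had. *)
Lemma meeting_round_replace_players (k : nat) (P : finType) (T : knockout k P)
    (f : P -> P) (f_inj : injective f) (x y : P) :
  meeting_round (replace_players T f_inj) (f x) (f y) = meeting_round T x y.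
Proof.
by apply: eq_ex_minn => i; rewrite /same_subtree !position_replace_players.
Qed.

Lemma replace_players_inj (k : nat) (P : finType) (T : knockout k P)
    (f g : P -> P) (f_inj : injective f) (g_inj : injective g) :
  replace_players T f_inj = replace_players T g_inj -> f =1 g.
Proof.
move=> /(congr1 (fun T' => tval (seeding T'))) /= /eq_in_map fg x.
exact/fg/mem_seeding.
Qed.

Section Family.
Variables (q : {poly 'F_2}) (qI : irreducible_poly q) (k : nat).
Implicit Type T : knockout k (GF qI).

Lemma tournament_mul_inj T : injective (tournament_mul T).
Proof.
move=> z z' /replace_players_inj/(_ 1); rewrite !mulr1; exact: val_inj.
Qed.

Lemma meeting_round_tournament_mul T (z : {z : GF qI | z != 0}) (x y : GF qI) :
  meeting_round (tournament_mul T z) x y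
    = meeting_round T (x / val z) (y / val z).
Proof.
(* Read from right to left: [x / z] and [y / z] in [T] become [z * (x / z)] and [z * (y / z)] in
   [T(z)]. *)
rewrite -(meeting_round_replace_players T (mulfI (valP z))).
by rewrite ![val z * _]mulrC !divfK ?(valP z).
Qed.

Lemma card_tournament_family T : #|tournament_family T| = (2 ^ k - 1)%N.
Proof.
rewrite card_imset; last exact: tournament_mul_inj.
(* The order of the field is read off the seeding of [T], which lists each element once. *)
by rewrite card_sig -(card_players T) cardC1 subn1.
Qed.

Lemma card_tournament_family_round T (x y : GF qI) (i : nat) :
  (forall x y : GF qI, x != y ->
     meeting_round T x y = (1 + degree (x - y)%R)%N) ->
  x != y ->
  #|[set T' in tournament_family T | meeting_round T' x y == i]|
    = #|[set w : {w : GF qI | w != 0} | (1 + degree (val w))%N == i]|.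
Proof.
move=> hT xy; have xy0 : x - y != 0 by rewrite subr_eq0.
have div_neq0 (z : {z : GF qI | z != 0}) : (x - y) / val z != 0.
  by rewrite mulf_neq0 ?invr_neq0 ?(valP z).
(* If [w = (x - y) / z] then [z = (x - y) / w], so this permutation is its own inverse. *)
pose quo z : {z : GF qI | z != 0} := Sub ((x - y) / val z) (div_neq0 z).
have quoK : involutive quo.
  by move=> z; apply: val_inj; rewrite /= invfM invrK mulVKf.
(* The right-hand set is carried by [quo] and then by [tournament_mul T], so that both sides become
   sets of tournaments with the same members. *)
rewrite -(card_imset _ (inv_inj quoK)).
rewrite -(card_imset _ (@tournament_mul_inj T)).
have round z : meeting_round (tournament_mul T z) x y
    = (1 + degree (val (quo z)))%N.
  rewrite meeting_round_tournament_mul hT; first by rewrite -mulrBl.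
  by rewrite (inj_eq (mulIf (invr_neq0 (valP z)))).
apply: eq_card => T'; rewrite inE; apply/andP/imsetP.
  move=> [/imsetP[z _ ->]]; rewrite round => ri; exists z => //.
  by rewrite -(quoK z) imset_f // inE.
move=> [_ /imsetP[w wi ->] ->]; rewrite imset_f //; split=> //.
by rewrite round quoK; rewrite inE in wi.
Qed.

End Family.

Theorem theorem3p1 (k : nat) (hk : (2 <= k)%N)
    (q : {poly 'F_2}) (qI : irreducible_poly q) (hq : size q = k.+1)
    (T : knockout k (GF qI))
    (hT : forall x y : GF qI, x != y ->
      meeting_round T x y = (1 + degree (x - y)%R)%N) :
  stable (tournament_family T) /\ serial_knockout_competition (tournament_family T).
Proof.
split; last exact: card_tournament_family.
(* The constant is found by unification: the count of nonzero [w] of degree [i - 1] mentions neither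
   [x] nor [y]. *)
move=> i _; eexists=> x y; exact: card_tournament_family_round.
Qed.
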